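(* Let $Y$ be a real vector space, $F\subseteq Y$, $D\subseteq Y$ with $D\ne Y$, and $a\in Y$. Suppose $C$ is a non-trivial algebraically closed convex pointed cone in $Y$ with $k\in\operatorname{core}C$ and $F\subseteq a+C$. Define $$\Psi:=\operatorname{argmin}_{y\in F}\|y-a\|_{C,k}.$$ Then: (a) $\operatorname{Eff}(F,D)\cap\Psi\subseteq\operatorname{Eff}(\Psi,D)$. (b) If $C+D\subseteq C$, then $\operatorname{Eff}(F,D)\cap\Psi=\operatorname{Eff}(\Psi,D)$. (c) If $C+D\subseteq C$ and $\Psi=\{y^0\}$, then $y^0\in\operatorname{Eff}(F,D)$. (d) If $C+(D\setminus\{0\})\subseteq\operatorname{core}C$, then $\Psi\subseteq\operatorname{Eff}(F,D)$. (e) If $C+\operatorname{core}D\subseteq\operatorname{core}C$, then $\Psi\subseteq\operatorname{WEff}(F,D)$.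
   Context: For $F,D\subseteq Y$, $\operatorname{Eff}(F,D):=\{y^0\in F\mid F\cap(y^0-D)\subseteq\{y^0\}\}$ and $\operatorname{WEff}(F,D):=\operatorname{Eff}(F,\operatorname{core}D)$. $\operatorname{core}D$ is the algebraic interior: $d\in\operatorname{core}D$ iff $d\in D$ and for each $v\in Y$ there is $\varepsilon>0$ with $d+sv\in D$ for all $s\in[0,\varepsilon]$. A set $C\subseteq Y$ is a cone iff $\lambda c\in C$ for all $\lambda\in[0,\infty)$, $c\in C$; non-trivial iff $C\ne\emptyset$, $C\ne\{0\}$, $C\ne Y$; pointed iff $C\cap(-C)=\{0\}$; algebraically closed iff for all $c\in C$, $y\in Y$: if $c+\lambda(y-c)\in C$ for all $\lambda\in(0,1)$, then $y\in C$. For such a cone $C$ and $k\in\operatorname{core}C$, $\|\cdot\|_{C,k}$ denotes the Minkowski functional of the order interval $[-k,k]_C=(C-k)\cap(k-C)$, i.e. $\|y\|_{C,k}=\inf\{\lambda>0\mid y\in\lambda[-k,k]_C\}$; it is a known fact that this is a norm on $Y$. $\operatorname{argmin}$ denotes the (possibly empty) set of minimizers. *)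

(* Defs.v *)
From HB Require Import structures.
From mathcomp Require Import all_boot all_order all_algebra.
From mathcomp Require Import boolp classical_sets reals convex.

Set Implicit Arguments.
Unset Strict Implicit.
Unset Printing Implicit Defensive.

Import Order.TTheory GRing.Theory Num.Theory.
Local Open Scope classical_set_scope.
Local Open Scope ring_scope.

Definition add_set (V : zmodType) (A B : set V) : set V :=
  [set x + y | x in A & y in B].

Definition opp_set (V : zmodType) (A : set V) : set V := [set - x | x in A].

(* [pt_sub y D] is y - D, [set_subpt A k] is A - k, [pt_sub k A] is k - A. *)
Definition pt_sub (V : zmodType) (y : V) (D : set V) : set V :=
  [set y - d | d in D].

Definition set_subpt (V : zmodType) (A : set V) (k : V) : set V :=
  [set x - k | x in A].

Definition scale_set (R : realType) (V : lmodType R) (l : R) (A : set V) :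
  set V := [set l *: x | x in A].

(* Algebraic interior (not the topological one: V carries no topology). *)
Definition core (R : realType) (V : lmodType R) (D : set V) : set V :=
  [set d | D d /\
    forall v : V, exists2 e : R, 0 < e &
      forall s : R, 0 <= s <= e -> D (d + s *: v)].

Definition Eff (V : zmodType) (F D : set V) : set V :=
  [set y0 | F y0 /\ F `&` pt_sub y0 D `<=` [set y0]].

Definition WEff (R : realType) (V : lmodType R) (F D : set V) : set V :=
  Eff F (core D).

(* The empty set is a cone here; it is excluded by [nontrivial_set]. *)
Definition is_cone (R : realType) (V : lmodType R) (C : set V) : Prop :=
  forall (l : R) (c : V), 0 <= l -> C c -> C (l *: c).

Definition nontrivial_set (V : zmodType) (C : set V) : Prop :=
  [/\ C <> set0, C <> [set 0] & C <> [set: V]].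

Definition pointed_set (V : zmodType) (C : set V) : Prop :=
  C `&` opp_set C = [set 0].

Definition algebraically_closed (R : realType) (V : lmodType R) (C : set V) :
    Prop :=
  forall c y : V, C c ->
    (forall l : R, 0 < l < 1 -> C (c + l *: (y - c))) -> C y.

Definition order_interval (V : zmodType) (C : set V) (k : V) : set V :=
  set_subpt C k `&` pt_sub k C.

(* [inf] is real-valued, with value 0 on the empty set; the infimum below is
   over a nonempty set for every y as soon as B is absorbing, as is the case
   for [order_interval C k] with C a cone and k in [core C]. *)
Definition minkowski_functional (R : realType) (V : lmodType R) (B : set V)
    (y : V) : R :=
  inf [set l : R | 0 < l /\ scale_set l B y].

Definition cone_norm (R : realType) (V : lmodType R) (C : set V) (k y : V) : R :=
  minkowski_functional (order_interval C k) y.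

Definition argmin (R : realType) (T : Type) (F : set T) (f : T -> R) : set T :=
  [set y | F y /\ forall z, F z -> f y <= f z].

(* Main.v *)
Require Import Defs.
From HB Require Import structures.
From mathcomp Require Import all_boot all_order all_algebra.
From mathcomp Require Import boolp classical_sets reals convex.
From mathcomp Require Import interval_inference.
From mathcomp Require Import ring lra.

Set Implicit Arguments.
Unset Strict Implicit.
Unset Printing Implicit Defensive.

Import Order.TTheory GRing.Theory Num.Theory.
Local Open Scope classical_set_scope.
Local Open Scope ring_scope.

(** The norm is only ever evaluated on [F - a], which lies in the cone [C]. For
    [y] in [C] the constraint [y \in l (C - k)] is automatic, so that
    [cone_norm C k y] is the infimum of the [l > 0] with [l k - y] in [C]
    ([cone_norm_coneE]). Part (a) is general: efficiency in [F] passes to subsets.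

    Adding to [z \in C] an element [d] with [C + d] inside [C] only shrinks the
    set of admissible [l], so the norm is monotone ([cone_norm_mono]). If [y]
    in [F] dominates a minimizer [y0], i.e. [y0 = y + d] with [d \in D], then [y]
    is a minimizer as well when [C + D] is inside [C]; hence being efficient
    among the minimizers is the same as being efficient in [F]. This gives (b),
    and (c) because a singleton is its own efficient set.

    For (d), algebraic closedness makes the infimum attained
    ([cone_norm_attained]): with [m] the norm of [y0 - a], the point
    [m k - (y0 - a)] is in [C], so adding [d != 0] brings [m k - (y - a)] into the
    core of [C]. There is then room to decrease [m] slightly in the direction
    of [k] ([cone_norm_lt]), and [y] has strictly smaller norm than the minimizer
    [y0], which is absurd. Decreasing [m] requires [m > 0]; this holds because
    [y0 - a = (y - a) + d] is itself in the core, where the norm of a proper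
    pointed algebraically closed cone does not vanish ([cone_norm_core_gt0]).

    Statement (e) is (d) with [core D] in place of [D]. *)

(** Midpoints suffice: [x + y] is twice the midpoint of [x] and [y]. *)
Lemma convex_cone_add (R : realType) (V : lmodType R) (C : set V) :
  is_cone C -> convex_set C -> forall x y, C x -> C y -> C (x + y).
Proof.
move=> C_cone vC x y Cx Cy.
have h1 : 0 <= 2^-1 :> R by rewrite invr_ge0.
have h2 : 2^-1 <= 1 :> R by lra.
have Cm : C (2^-1 *: x + (1 - 2^-1) *: y).
  exact: set_mem (vC x y (Itv01 h1 h2) (mem_set Cx) (mem_set Cy)).
have half : 1 - 2^-1 = 2^-1 :> R by lra.
suff -> : x + y = 2 *: (2^-1 *: x + (1 - 2^-1) *: y) by apply: C_cone.
by rewrite half -scalerDr scalerA divff ?scale1r // pnatr_eq0.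
Qed.

Lemma core_sub (R : realType) (V : lmodType R) (D : set V) : core D `<=` D.
Proof. by move=> d []. Qed.

Lemma core0_cone (R : realType) (V : lmodType R) (C : set V) :
  is_cone C -> core C 0 -> C = setT.
Proof.
move=> C_cone [_ core0]; rewrite -subTset => v _.
have [e e0 /(_ e)] := core0 v.
rewrite ltW // lexx add0r => /(_ isT) Cev.
rewrite -[v]scale1r -(mulVf (lt0r_neq0 e0)) -scalerA.
by apply: C_cone; rewrite // invr_ge0 ltW.
Qed.

(** This makes the set of admissible radii nonempty, so that the infimum defining
    the norm is a genuine one: apply the core property in the direction [- y] and
    rescale. *)
Lemma core_absorb (R : realType) (V : lmodType R) (C : set V) (k : V) :
  is_cone C -> core C k ->
  forall y, exists2 l : R, 0 < l & C (l *: k - y).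
Proof.
move=> C_cone [_ kcore] y.
have [e e0 /(_ e)] := kcore (- y).
rewrite ltW // lexx => /(_ isT) Cey.
exists e^-1; rewrite ?invr_gt0 //.
have -> : e^-1 *: k - y = e^-1 *: (k + e *: - y).
  by rewrite scalerDr scalerA mulVf ?lt0r_neq0 // scale1r.
by apply: C_cone; rewrite // invr_ge0 ltW.
Qed.

Section ConeNorm.
Context (R : realType) (V : lmodType R) (C : set V) (k : V).
Hypotheses (C_cone : is_cone C) (C_add : forall x y, C x -> C y -> C (x + y)).
Hypothesis (k_core : core C k).

Let Ck : C k. Proof. exact: core_sub k_core. Qed.

(** On the cone, [y \in l (C - k)] holds for every [l > 0] and only the upper
    bound of the order interval matters. *)
Lemma cone_norm_coneE y : C y ->
  cone_norm C k y = inf [set l : R | 0 < l /\ C (l *: k - y)].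
Proof.
move=> Cy; congr inf; apply/seteqP; split=> l /= [l0].
  case=> w [_ [x Cx xw]] <-; split=> //; rewrite -xw.
  by rewrite scalerBr subKr; apply: C_cone; rewrite // ltW.
move=> Clk; split=> //; exists (l^-1 *: y); last first.
  by rewrite scalerA divff ?lt0r_neq0 // scale1r.
have li0 : 0 <= l^-1 by rewrite invr_ge0 ltW.
split.
  by exists (l^-1 *: y + k); [apply: C_add => //; exact: C_cone | rewrite addrK].
exists (l^-1 *: (l *: k - y)); first exact: C_cone.
by rewrite scalerBr scalerA mulVf ?lt0r_neq0 // scale1r subKr.
Qed.

Let radii y := [set l : R | 0 < l /\ C (l *: k - y)].

Let radii_neq0 y : radii y !=set0.
Proof. by have [l] := core_absorb C_cone k_core y; exists l. Qed.

Let radii_lb y : has_lbound (radii y).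
Proof. by exists 0 => l [/ltW]. Qed.

Lemma cone_norm_ge0 y : C y -> 0 <= cone_norm C k y.
Proof.
by move=> Cy; rewrite cone_norm_coneE //; apply: (lb_le_inf (radii_neq0 _)) => l [/ltW].
Qed.

(** The hypothesis says that [C] is stable under adding [z - y]; adding it to
    [l k - z] gives [l k - y], so a radius admissible for [z] is admissible
    for [y]. The order relation is stated this way because [z - y] comes from
    the domination set [D] and not from [C]. *)
Lemma cone_norm_mono y z : C y -> C z ->
  (forall x, C x -> C (x + (z - y))) -> cone_norm C k y <= cone_norm C k z.
Proof.
move=> Cy Cz Czy; rewrite !cone_norm_coneE //; apply: (lb_le_inf (radii_neq0 _)) => l [l0 Cl].
apply: (ge_inf (radii_lb _)); split=> //.
by have := Czy _ Cl; rewrite addrA subrK.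
Qed.

(** Every radius above the norm is admissible, and algebraic closedness passes
    to the limit along the segment from [(m + 1) k - y] to [m k - y]. *)
Lemma cone_norm_attained y : algebraically_closed C -> C y ->
  C (cone_norm C k y *: k - y).
Proof.
move=> C_closed Cy; set m := cone_norm C k y.
have above l : m < l -> C (l *: k - y).
  rewrite /m cone_norm_coneE // => /(inf_lt (radii_neq0 y))[l' [_ Cl'] l'l].
  have -> : l *: k - y = (l' *: k - y) + (l - l') *: k.
    by rewrite addrAC -scalerDl [l' + _]addrC subrK.
  by apply: C_add => //; apply: C_cone; rewrite // subr_ge0 ltW.
apply: (C_closed ((m + 1) *: k - y)); first by apply: above; lra.
move=> l /andP[l0 l1].
have -> : (m + 1) *: k - y + l *: (m *: k - y - ((m + 1) *: k - y))
          = (m + 1 - l) *: k - y.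
  rewrite opprB addrA subrK -scalerBl scalerA addrAC -scalerDl.
  by congr (_ *: _ - _); ring.
by apply: above; lra.
Qed.

(** A core point leaves room to move in the direction [- k], that is, to lower the
    radius. *)
Lemma cone_norm_lt y (m : R) : C y -> 0 < m -> core C (m *: k - y) ->
  cone_norm C k y < m.
Proof.
move=> Cy m0 [_ /(_ (- k))[e e0 Ce]].
(* The bound [m / 2] keeps the lowered radius [m - t] positive. *)
pose t := Num.min e (m / 2).
have t0 : 0 < t by rewrite lt_min e0 divr_gt0.
have te : t <= e by rewrite ge_min lexx.
have tm : t <= m / 2 by rewrite ge_min lexx orbT.
apply: (@le_lt_trans _ _ (m - t)); last by lra.
rewrite cone_norm_coneE //; apply: (ge_inf (radii_lb _)); split; first by lra.
by rewrite scalerBl addrAC -scalerN; apply: Ce; rewrite ltW.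
Qed.

(** A core point of norm zero would be in [- C], hence be [0] by pointedness,
    and a cone with [0] in its core is the whole space. *)
Lemma cone_norm_core_gt0 y :
  algebraically_closed C -> pointed_set C -> C <> setT ->
  core C y -> 0 < cone_norm C k y.
Proof.
move=> C_closed C_pointed C_proper y_core.
have Cy := core_sub y_core.
rewrite lt_neqAle cone_norm_ge0 // andbT; apply/eqP => n0.
have := cone_norm_attained C_closed Cy; rewrite -n0 scale0r add0r => CNy.
have : (C `&` opp_set C) y by split=> //; exists (- y); rewrite ?opprK.
rewrite C_pointed => y0.
by apply: C_proper; apply: core0_cone => //; rewrite -y0.
Qed.

End ConeNorm.

Lemma Eff_sub (V : zmodType) (F G D : set V) :
  G `<=` F -> Eff F D `&` G `<=` Eff G D.
Proof. by move=> GF y [[_ effy] Gy]; split=> // z [/GF Fz zD]; apply: effy. Qed.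

Section Scalarization.
Context (R : realType) (V : lmodType R) (F C : set V) (a k : V).
Hypotheses (C_cone : is_cone C) (C_add : forall x y, C x -> C y -> C (x + y)).
Hypotheses (k_core : core C k) (F_above : F `<=` add_set [set a] C).

Let Psi := argmin F (fun y => cone_norm C k (y - a)).

Let F_cone y : F y -> C (y - a).
Proof. by case/F_above => _ -> [c Cc <-]; rewrite addrAC subrr add0r. Qed.

Lemma argmin_dominated (D : set V) y0 :
  add_set C D `<=` C -> Psi y0 -> F `&` pt_sub y0 D `<=` Psi.
Proof.
move=> CD [Fy0 min0] y [Fy [d Dd yE]]; split=> // z /min0; apply: le_trans.
apply: cone_norm_mono => //; [exact: F_cone | exact: F_cone | move=> x Cx].
apply: CD; exists x => //; exists d => //.
by rewrite -yE; congr (_ + _); rewrite opprB addrA subrK subKr.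
Qed.

(** Any witness against the efficiency of a minimizer in [F] is a minimizer by
    [argmin_dominated], hence already a witness among the minimizers. *)
Lemma Eff_argmin (D : set V) :
  add_set C D `<=` C -> Eff F D `&` Psi = Eff Psi D.
Proof.
move=> CD; apply/seteqP; split; first by apply: Eff_sub => y [].
move=> y0 [Psi0 eff0]; split=> //; split; first by case: Psi0.
by move=> y [Fy Dy]; apply: eff0; split=> //; apply: (argmin_dominated CD Psi0).
Qed.

(** A point [y <> y0] dominating the minimizer [y0] would have strictly smaller
    norm: the nonzero [d] pushes both [y0 - a] and [m k - (y - a)] into the core,
    which gives respectively [m > 0] and the strict inequality. *)
Lemma argmin_sub_Eff (D : set V) :
  algebraically_closed C -> pointed_set C -> C <> setT ->
  add_set C (D `\` [set 0]) `<=` core C -> Psi `<=` Eff F D.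
Proof.
move=> C_closed C_pointed C_proper CD y0 [Fy0 min0]; split=> // y [Fy [d Dd yE]].
have [d0|dN0] := pselect (d = 0); first by rewrite -yE d0 subr0.
have CDd x : C x -> core C (x + d).
  by move=> Cx; apply: CD; exists x => //; exists d.
have := min0 y Fy; rewrite leNgt => /negP[].
apply: cone_norm_lt => //; first exact: F_cone.
- apply: cone_norm_core_gt0 => //.
  have -> : y0 - a = y - a + d by rewrite -yE addrAC subrK.
  exact/CDd/F_cone.
- set m := cone_norm _ _ _.
  have -> : m *: k - (y - a) = m *: k - (y0 - a) + d.
    by rewrite -yE [y0 - d - a]addrAC opprB [d - _]addrC addrA.
  by apply: CDd; apply: cone_norm_attained => //; apply: F_cone.
Qed.

End Scalarization.

Theorem theorem10 (R : realType) (Y : lmodType R) (F D : set Y) (a : Y)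
    (C : set Y) (k : Y)
    (hD : D <> [set: Y])
    (C_cone : is_cone C) (C_nontrivial : nontrivial_set C)
    (C_closed : algebraically_closed C) (C_convex : convex_set C)
    (C_pointed : pointed_set C)
    (hk : core C k)
    (hF : F `<=` add_set [set a] C) :
  let Psi := argmin F (fun y => cone_norm C k (y - a)) in
  [/\ Eff F D `&` Psi `<=` Eff Psi D,
      add_set C D `<=` C -> Eff F D `&` Psi = Eff Psi D,
      add_set C D `<=` C -> forall y0 : Y, Psi = [set y0] -> Eff F D y0,
      add_set C (D `\` [set 0]) `<=` core C -> Psi `<=` Eff F D
    & add_set C (core D) `<=` core C -> Psi `<=` WEff F D].
Proof.
have C_add := convex_cone_add C_cone C_convex.
have [_ _ C_proper] := C_nontrivial.
move=> Psi; split.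
- by apply: Eff_sub => y [].
- exact: Eff_argmin.
- move=> CD y0 Psi1; suff [] : (Eff F D `&` Psi) y0 by [].
  by rewrite Eff_argmin // -/Psi Psi1; split=> // y [].
- exact: argmin_sub_Eff.
(* Weak efficiency is efficiency with respect to [core D]. *)
- move=> CD; apply: argmin_sub_Eff => // _ [x Cx [d [Dd _] <-]].
  by apply: CD; exists x => //; exists d.
Qed.
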